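(* Let $\mathcal S=(\mathcal U,\tilde\varphi,(\iota^{(i)})_{i\ge1})$ be a spreadability system for a $\mathcal B$-valued noncommutative probability space $(\mathcal A,\varphi)$. For $\pi=(P_1,\dots,P_p)\in\mathcal{OP}_n$, $\underline t=(t_1,\dots,t_p)\in\mathbb R^p$, $j\in[p]$ and $X_1,\dots,X_n\in\mathcal A$ we have $$\frac{\partial}{\partial t_j}\varphi_\pi^{\underline t}(X_1,\dots,X_n)=\sum_{\emptyset\ne A\subseteq P_j}K^{(t_1,\dots,t_{j-1},1,t_j,t_{j+1},\dots,t_p)}_{(P_1,\dots,P_{j-1},A,P_j\setminus A,P_{j+1},\dots,P_p),\,A}(X_1,\dots,X_n)$$ $$=\sum_{\emptyset\ne A\subseteq P_j}K^{(t_1,\dots,t_{j-1},t_j,1,t_{j+1},\dots,t_p)}_{(P_1,\dots,P_{j-1},P_j\setminus A,A,P_{j+1},\dots,P_p),\,A}(X_1,\dots,X_n),$$ where in the term $A=P_j$ the empty block $P_j\setminus A$ is dropped together with its parameter $t_j$.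
   Context: Ordered set partitions. $\mathbb N=\{1,2,\dots\}$, $[n]=\{1,\dots,n\}$. An ordered set partition of $[n]$ is a sequence $\pi=(P_1,\dots,P_p)$ of pairwise disjoint nonempty blocks with union $[n]$; $\mathcal{OP}_n$ is the set of them; $\pi(i)$ denotes the index $k$ with $i\in P_k$. The quasi-meet of $\pi$ and $\sigma=(S_1,\dots,S_s)$ is $\pi\curlywedge\sigma=(P_1\cap S_1,P_1\cap S_2,\dots,P_1\cap S_s,P_2\cap S_1,\dots,P_p\cap S_s)$ with empty sets removed. The ordered kernel $\kappa(i_1,\dots,i_n)\in\mathcal{OP}_n$ has as blocks the level sets $\{k:i_k=v\}$ listed in increasing order of $v$. Spreadability systems. Algebras are associative over $\mathbb C$. A $\mathcal B$-valued noncommutative probability space is an algebra $\mathcal A$ with a linear map $\varphi:\mathcal A\to\mathcal B$ into an algebra $\mathcal B$. A spreadability system for it is a triple $(\mathcal U,\tilde\varphi,(\iota^{(i)})_{i\ge1})$ with $\mathcal U$ an algebra, $\tilde\varphi:\mathcal U\to\mathcal B$ linear, $\iota^{(i)}:\mathcal A\to\mathcal U$ homomorphisms with $\varphi=\tilde\varphi\circ\iota^{(i)}$, such that, writing $X^{(i)}=\iota^{(i)}(X)$, $\tilde\varphi(X_1^{(i_1)}\cdots X_n^{(i_n)})=\tilde\varphi(X_1^{(h(i_1))}\cdots X_n^{(h(i_n))})$ for all $X_k\in\mathcal A$, $i_k\in\mathbb N$ and all $h:\{i_1,\dots,i_n\}\to\mathbb N$ with $i_p<i_q\Rightarrow h(i_p)<h(i_q)$.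 For $\pi\in\mathcal{OP}_n$, $\varphi_\pi(X_1,\dots,X_n):=\tilde\varphi(X_1^{(i_1)}\cdots X_n^{(i_n)})$ for any indices with $\kappa(i_1,\dots,i_n)=\pi$, and $\varphi_\pi(M_1.X_1,\dots,M_n.X_n):=\sum_{i_1=1}^{M_1}\cdots\sum_{i_n=1}^{M_n}\varphi_{\pi\curlywedge\kappa(i_1,\dots,i_n)}(X_1,\dots,X_n)$ for $M_k\in\mathbb N$. Moment polynomials. For $\pi=(P_1,\dots,P_p)$, $\varphi_\pi(N_{\pi(1)}.X_1,\dots,N_{\pi(n)}.X_n)$ is a polynomial in $N_1,\dots,N_p\in\mathbb N$ with coefficients in $\mathcal B$; replacing $N_1,\dots,N_p$ by real numbers $t_1,\dots,t_p$ gives the polynomial $\varphi_\pi^{\underline t}(X_1,\dots,X_n)$, $\underline t=(t_1,\dots,t_p)\in\mathbb R^p$. Derivatives are taken formally (of polynomials). Partial cumulants. For $\pi=(P_1,\dots,P_p)\in\mathcal{OP}_n$, $\underline t\in\mathbb R^p$, $j\in[p]$, $$K_{\pi,P_j}^{(t_1,\dots,t_{j-1},1,t_{j+1},\dots,t_p)}(X_1,\dots,X_n)=\frac{\partial}{\partial t_j}\Big|_{t_j=0}\varphi_\pi^{\underline t}(X_1,\dots,X_n)$$ (the superscript lists the parameters attached to the blocks of $\pi$ in order, with a $1$ in the position of the distinguished block). *)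

(* Defs.v *)
From HB Require Import structures.
From mathcomp Require Import all_boot all_order all_algebra.
From mathcomp Require classical_sets.
From mathcomp Require Import reals complex.
From mathcomp Require Import finmap monalg.

Set Implicit Arguments.
Unset Strict Implicit.
Unset Printing Implicit Defensive.

Import Order.TTheory GRing.Theory Num.Theory.
Local Open Scope ring_scope.

(* Associative algebras that need not have a unit; MathComp's [algType] is
   unital.  An [algType K] becomes an instance with [amul := *%R]. *)
HB.mixin Record isAssocAlgebra (K : nzRingType) V of GRing.Lmodule K V := {
  amul : V -> V -> V;
  amulA : associative amul;
  amulDl : left_distributive amul +%R;
  amulDr : right_distributive amul +%R;
  amulZl : forall (c : K) (x y : V), amul (c *: x) y = c *: amul x y;
  amulZr : forall (c : K) (x y : V), amul x (c *: y) = c *: amul x y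
}.

#[short(type="assocAlgType")]
HB.structure Definition AssocAlgebra (K : nzRingType) :=
  { V of isAssocAlgebra K V & GRing.Lmodule K V }.

(* [aprod [:: x1; ..; xn]] is x1 ... xn for n >= 1.  There is no unit, so the
   value 0 on the empty sequence is only a placeholder. *)
Definition aprod (K : nzRingType) (V : assocAlgType K) (s : seq V) : V :=
  if s is x :: s' then foldl amul x s' else 0.

Section OrderedSetPartitions.
Variable n : nat.
Implicit Types (pi sigma : seq {set 'I_n}).

Definition ordered_set_partition pi : bool :=
  [&& set0 \notin pi,
      pairwise (fun P Q : {set 'I_n} => [disjoint P & Q]) pi
    & \bigcup_(P <- pi) P == [set: 'I_n]].

(* Block indices are counted from 0: [block_index pi k] is pi(k) - 1. *)
Definition block_index pi (k : 'I_n) : nat :=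
  find (fun P : {set _} => k \in P) pi.

Definition quasi_meet pi sigma : seq {set 'I_n} :=
  [seq B <- [seq P :&: Q | P <- pi, Q <- sigma] | B != set0].

Definition ordered_kernel (i : 'I_n -> nat) : seq {set 'I_n} :=
  [seq [set k | i k == v] | v <- sort leq (undup (codom i))].

Lemma ordered_kernel_osp (i : 'I_n -> nat) :
  ordered_set_partition (ordered_kernel i).
Proof.
set s := sort leq (undup (codom i)).
have ms v : (v \in s) = (v \in codom i) by rewrite mem_sort mem_undup.
apply/and3P; split.
- apply/mapP => -[v]; rewrite ms => /codomP[k ->] /setP/(_ k).
  by rewrite !inE eqxx.
- rewrite pairwise_map.
  have: uniq s by rewrite sort_uniq undup_uniq.
  rewrite uniq_pairwise; apply: sub_pairwise => u v /= uv.
  rewrite disjoint_subset; apply/subsetP => k; rewrite !inE => /eqP->.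
  exact: uv.
- apply/eqP/setP => k; rewrite inE big_map.
  by rewrite (big_rem (i k)) ?ms ?codom_f //= !inE eqxx.
Qed.

(* The block P_j is replaced by (A, P_j \ A), respectively (P_j \ A, A), where
   P_j \ A is omitted if A = P_j. *)
Definition split_front pi (j : nat) (A : {set 'I_n}) : seq {set 'I_n} :=
  let P := nth set0 pi j in
  take j pi ++ (if A == P then [:: A] else [:: A; P :\: A]) ++ drop j.+1 pi.

Definition split_back pi (j : nat) (A : {set 'I_n}) : seq {set 'I_n} :=
  let P := nth set0 pi j in
  take j pi ++ (if A == P then [:: A] else [:: P :\: A; A]) ++ drop j.+1 pi.

(* The matching parameter lists: 1 is attached to A and t_j to P_j \ A. *)
Definition params_front (R : nzRingType) pi (j : nat) (A : {set 'I_n})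
    (t : seq R) : seq R :=
  take j t ++ (if A == nth set0 pi j then [:: 1] else [:: 1; t`_j])
    ++ drop j.+1 t.

Definition params_back (R : nzRingType) pi (j : nat) (A : {set 'I_n})
    (t : seq R) : seq R :=
  take j t ++ (if A == nth set0 pi j then [:: 1] else [:: t`_j; 1])
    ++ drop j.+1 t.

End OrderedSetPartitions.

(* Polynomials in p variables with coefficients in a complex vector space B:
   finitely supported families of elements of B indexed by the monomials. *)
Section VectorPolynomials.
Variables (R : realType) (B : lmodType R[i]) (p : nat).

Definition vpeval (f : {malg B['X_{1..p}]}) (t : seq R) : B :=
  \sum_(m <- msupp f)
     real_complex R (\prod_(k < p) t`_k ^+ m k) *: mcoeff m f.

Definition vpderiv (j : 'I_p) (f : {malg B['X_{1..p}]}) :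
    {malg B['X_{1..p}]} :=
  \sum_(m <- msupp f)
     << mcoeff m f *+ m j *g divcm m (ucm j) >>.

End VectorPolynomials.

(* The copies of A are indexed by nat instead of {1, 2, ..}: [ss_iota i]
   stands for iota^(i+1).  Only the order of the indices is ever used. *)
Record spreadability_system (R : realType) (A B : assocAlgType R[i])
    (phi : {linear A -> B}) := SpreadabilitySystem {
  ss_alg : assocAlgType R[i];
  ss_phi : {linear ss_alg -> B};
  ss_iota : nat -> {linear A -> ss_alg};
  ss_iotaM : forall i, {morph ss_iota i : x y / amul x y >-> amul x y};
  ss_phi_iota : forall i x, phi x = ss_phi (ss_iota i x);
  ss_spread : forall (n : nat) (X : 'I_n -> A) (i : 'I_n -> nat)
    (h : nat -> nat),
    (forall k l, (i k < i l)%N -> (h (i k) < h (i l))%N) ->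
    ss_phi (aprod [seq ss_iota (i k) (X k) | k <- enum 'I_n]) =
    ss_phi (aprod [seq ss_iota (h (i k)) (X k) | k <- enum 'I_n])
}.

Lemma sorted_index_ltn (s : seq nat) (u v : nat) :
  uniq s -> sorted leq s -> u \in s -> v \in s -> (u < v)%N ->
  (index u s < index v s)%N.
Proof.
move=> us ss us' vs uv; rewrite ltnNge; apply/negP => le.
have := sorted_leq_nth leq_trans leqnn 0%N ss.
move=> /(_ (index v s) (index u s)); rewrite !inE !index_mem => /(_ vs us' le).
by rewrite !nth_index // leqNgt uv.
Qed.

Section Cumulants.
Variables (R : realType) (A B : assocAlgType R[i]) (phi : {linear A -> B}).
Variable S : spreadability_system phi.
Variables (n : nat).
Implicit Types (pi : seq {set 'I_n}) (X : 'I_n -> A).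

Definition moment (i : 'I_n -> nat) X : B :=
  ss_phi S (aprod [seq ss_iota S (i k) (X k) | k <- enum 'I_n]).

(* phi_pi(X_1, .., X_n), computed with the indices i_k = pi(k), whose ordered
   kernel is pi; see [phi_partE] for the independence of that choice. *)
Definition phi_part pi X : B := moment (block_index pi) X.

Lemma phi_partE pi X (i : 'I_n -> nat) :
  ordered_kernel i = pi -> moment i X = phi_part pi X.
Proof.
move=> <-; rewrite /phi_part /moment; set s := sort leq (undup (codom i)).
have is_ k : i k \in s by rewrite mem_sort mem_undup codom_f.
have bE k : block_index (ordered_kernel i) k = index (i k) s.
  rewrite /block_index /ordered_kernel find_map; apply: eq_find => v /=.
  by rewrite inE eq_sym.
rewrite (@ss_spread _ _ _ _ S n X i (index^~ s)).
  by congr (ss_phi S (aprod _)); apply: eq_map => k; rewrite bE.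
move=> k l; apply: sorted_index_ltn => //; first by rewrite sort_uniq undup_uniq.
exact: sort_sorted leq_total _.
Qed.

(* phi_pi(M_1.X_1, .., M_n.X_n) *)
Definition phi_dot pi (M : 'I_n -> nat) X : B :=
  \sum_(i : {dffun forall k : 'I_n, 'I_(M k)})
     phi_part (quasi_meet pi (ordered_kernel (fun k => i k : nat))) X.

Definition is_moment_poly pi X (f : {malg B['X_{1..size pi}]}) : Prop :=
  forall N : (size pi).-tuple nat, all (fun m => 0 < m)%N N ->
    vpeval f [seq m%:R | m <- N] =
    phi_dot pi (fun k => nth 0%N N (block_index pi k)) X.

(* The polynomial phi_pi^t in the variables t_1, .., t_p; it is the only one
   satisfying [is_moment_poly] when pi is an ordered set partition. *)
Definition moment_poly pi X : {malg B['X_{1..size pi}]} :=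
  classical_sets.xget 0 (is_moment_poly (pi := pi) X).

(* K_{pi, P}^t(X_1, .., X_n) for a block P of pi.  The entry of t at the
   position of P is the conventional 1, which is not used. *)
Definition partial_cumulant pi (P : {set 'I_n}) (t : seq R) X : B :=
  if insub (index P pi) is Some j then
    vpeval (vpderiv j (moment_poly pi X)) (set_nth 0 t j 0)
  else 0.

End Cumulants.

(* Main.v *)
Require Import Defs.
From mathcomp Require Import all_boot all_order all_algebra.
From mathcomp Require Import reals complex.
From mathcomp Require Import finmap monalg.
From mathcomp Require boolp classical_sets.
Set Implicit Arguments.
Unset Strict Implicit.
Unset Printing Implicit Defensive.
Import Order.TTheory GRing.Theory Num.Theory.
Local Open Scope ring_scope.

(** The two identities are the derivatives at u = 0, respectively at v = 0, of
    one additivity formula.  Write f_pi for the moment polynomial of pi and P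
    for its block number j.  Then
<<
      f_pi (.., u + v, ..) = sum over all subsets Q of P of
                             f_(.., Q, P \ Q, ..) (.., u, v, ..)
>>
    where an empty block is dropped together with its parameter.  The summand
    for the empty Q does not depend on u, and the others contribute the partial
    cumulants at u = 0; exchanging the roles of Q and P \ Q gives the
    derivative in v.

    For natural numbers the formula is a regrouping of a finite sum.  By
    spreadability a moment depends only on the relative order of its indices,
    so the dot moment of pi with multiplicities N is the sum of the moments of
    all colourings of 1, .., n that send the elements of block x into the x-th
    of consecutive intervals of lengths N_x ([phi_dot_placed]).  An interval of
    length u + v is cut into two of lengths u and v, and the colourings are
    grouped by the set Q of those elements of P whose colour lies in the lower
    part ([placed_moment_split]).

    The same regrouping with u = 1 shows that the dot moments are polynomial
    in N: the increment in one variable is a sum of dot moments in which fewer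
    elements sit in intervals of variable length, so induction and discrete
    summation of binomial coefficients apply ([newton_form_placed_moment]).

    Finally, a polynomial map with values in a vector space is determined,
    along with its formal derivative, by its values at positive integers
    ([polyfun_deriv_vanish], by Lagrange interpolation).  Freeing one variable
    at a time extends the additivity formula to real parameters
    ([split_moment_real]), and the formula may then be differentiated term by
    term. *)

(** * Vector-valued polynomial functions of one variable *)
Section VectorPolynomialFunctions.
Variables (R : realType) (B : lmodType R[i]).
Local Notation "r %:C" := (real_complex R r).

(** Formal differentiation of polynomial functions with values in [B], which
    has no topology.  It is a relation between functions, so that polynomials
    with different sets of variables can be compared once all but one of their
    variables are fixed. *)
Definition polyfun_deriv (g g' : R -> B) : Prop :=
  exists L : seq ({poly R} * B),
    (forall s, g s = \sum_(z <- L) (z.1.[s])%:C *: z.2) /\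
    (forall s, g' s = \sum_(z <- L) (z.1^`().[s])%:C *: z.2).

Lemma polyfun_deriv_ext (g1 g2 g1' g2' : R -> B) :
  g1 =1 g2 -> g1' =1 g2' -> polyfun_deriv g1 g1' -> polyfun_deriv g2 g2'.
Proof.
move=> e e' [L [h h']]; exists L.
by split=> s; [rewrite -e h | rewrite -e' h'].
Qed.

Lemma polyfun_deriv_cst (b : B) : polyfun_deriv (fun=> b) (fun=> 0).
Proof.
exists [:: (1, b)]; split=> s; rewrite big_seq1 /=.
  by rewrite hornerC rmorph1 scale1r.
by rewrite derivC horner0 rmorph0 scale0r.
Qed.

Lemma polyfun_derivD (g1 g2 g1' g2' : R -> B) :
  polyfun_deriv g1 g1' -> polyfun_deriv g2 g2' ->
  polyfun_deriv (fun s => g1 s + g2 s) (fun s => g1' s + g2' s).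
Proof.
move=> [L1 [h1 h1']] [L2 [h2 h2']]; exists (L1 ++ L2).
by split=> s; rewrite big_cat /= ?h1 ?h2 ?h1' ?h2'.
Qed.

Lemma polyfun_derivN (g g' : R -> B) :
  polyfun_deriv g g' -> polyfun_deriv (fun s => - g s) (fun s => - g' s).
Proof.
move=> [L [h h']]; exists [seq (z.1, - z.2) | z <- L].
by split=> s; rewrite big_map ?h ?h' -sumrN; apply: eq_bigr => z _;
  rewrite scalerN.
Qed.

Lemma polyfun_deriv_sum (I : Type) (r : seq I) (P : pred I)
    (g g' : I -> R -> B) :
  (forall i, P i -> polyfun_deriv (g i) (g' i)) ->
  polyfun_deriv (fun s => \sum_(i <- r | P i) g i s)
    (fun s => \sum_(i <- r | P i) g' i s).
Proof.
move=> h; elim: r => [|x r IH].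
  by apply: polyfun_deriv_ext (polyfun_deriv_cst 0) => s; rewrite big_nil.
case Px: (P x); last first.
  by apply: polyfun_deriv_ext IH => s; rewrite big_cons Px.
by apply: polyfun_deriv_ext (polyfun_derivD (h x Px) IH) => s;
  rewrite big_cons Px.
Qed.

(** Lagrange interpolation at 1, .., D writes every scalar polynomial of size at
    most D as a combination of its values there.  Hence any linear functional
    applied to the polynomial coefficients of [g], such as the evaluation at
    [s] of the polynomial or of its derivative, is a combination of the values
    g(1), .., g(D). *)
Lemma polyfun_deriv_vanish (g g' : R -> B) :
  polyfun_deriv g g' -> (forall m : nat, (0 < m)%N -> g m%:R = 0) ->
  forall s, g s = 0 /\ g' s = 0.
Proof.
move=> [L [h h']] g0 s.
pose D := (\max_(z <- L) size z.1).+1.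
have sD z : z \in L -> (size z.1 <= D)%N.
  by move=> zL; rewrite /D (big_rem z) //= leqW // leq_maxl.
pose x (i : nat) : R := i.+1%:R.
have xI : injective x by move=> i k /eqP; rewrite eqr_nat => /eqP[].
pose ell (i : 'I_D) : {poly R} := tnth (lagrange D x) i.
have interp z : z \in L ->
    z.1 = \sum_(i < D) z.1.[x i] *: (ell i).
  move=> zL; rewrite [LHS](lagrange_gen _ xI (sD z zL)) //.
  by apply: eq_bigr => i _; rewrite mul_polyC.
have scE (l : {poly R} -> R) : linear_for *%R l ->
    \sum_(z <- L) (l z.1)%:C *: z.2 = 0.
  move=> ll.
  have -> : \sum_(z <- L) (l z.1)%:C *: z.2 =
      \sum_(i < D) (l (ell i))%:C *: g (x i).
    under [RHS]eq_bigr => i _ do rewrite h scaler_sumr.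
    rewrite exchange_big /=; apply: eq_big_seq => z zL.
    have l0 : l 0 = 0.
      have := ll (- 1) 0 0; rewrite scaler0 addr0 mulN1r => e.
      by rewrite e addNr.
    rewrite {1}(interp z zL).
    rewrite (big_morph l (id1 := 0) (op1 := +%R)) //; last first.
      by move=> p q; have := ll 1 p q; rewrite scale1r mul1r.
    rewrite rmorph_sum /= scaler_suml; apply: eq_bigr => i _.
    have := ll (z.1).[x i] (ell i) 0.
    rewrite addr0 l0 addr0 => ->.
    by rewrite mulrC rmorphM /= scalerA.
  by rewrite big1 // => i _; rewrite g0 ?scaler0.
split.
  rewrite h; apply: (scE (fun p => p.[s])) => c p q.
  by rewrite hornerD hornerZ.
rewrite h'; apply: (scE (fun p => p^`().[s])) => c p q.
by rewrite derivD derivZ hornerD hornerZ.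
Qed.

Definition upd (T : Type) (e : nat -> T) (x : nat) (s : T) : nat -> T :=
  fun y => if y == x then s else e y.

Lemma upd_id T (e : nat -> T) x : upd e x (e x) = e.
Proof. by apply: boolp.funext => y; rewrite /upd; case: eqP => [->|]. Qed.

(** Identity theorem in several variables: the variables are freed from the
    integers one at a time, the bound [q] counting those already freed, and
    each step is an instance of the one-variable case. *)
Lemma separately_poly_vanish (F : (nat -> R) -> B) (q : nat) :
  (forall e x, exists g', polyfun_deriv (fun s => F (upd e x s)) g') ->
  (forall e, (forall x, exists2 m, (0 < m)%N & e x = m%:R) -> F e = 0) ->
  forall e, (forall x, (q <= x)%N -> exists2 m, (0 < m)%N & e x = m%:R) ->
  F e = 0.
Proof.
move=> sep F0; elim: q => [|q IH] e he; first by apply: F0 => x; apply: he.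
rewrite -(upd_id e q); have [g' hg] := sep e q.
apply: (proj1 (polyfun_deriv_vanish hg _ _)) => m m0; apply: IH => x qx.
rewrite /upd; case: eqP => [_|/eqP nx]; first by exists m.
by apply: he; rewrite ltn_neqAle eq_sym nx.
Qed.

(** * Evaluation and derivatives of polynomials in several variables *)
Section Evaluation.
Variable p : nat.
Implicit Types (f : {malg B['X_{1..p}]}) (t : seq R).

Lemma vpeval_supp f t (d : {fset 'X_{1..p}}) : fsubset (msupp f) d ->
  vpeval f t = \sum_(m <- d) (\prod_(k < p) t`_k ^+ m k)%:C *: mcoeff m f.
Proof.
move=> sd; apply: big_fset_incl => // m _ mf.
by rewrite mcoeff_outdom // scaler0.
Qed.

Lemma vpeval0 t : vpeval (0 : {malg B['X_{1..p}]}) t = 0.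
Proof. by rewrite /vpeval big1 // => m _; rewrite mcoeff0 scaler0. Qed.

Lemma vpevalD f1 f2 t : vpeval (f1 + f2) t = vpeval f1 t + vpeval f2 t.
Proof.
set d := fsetU (msupp f1) (msupp f2).
rewrite !(vpeval_supp _ (d := d)) ?fsubsetUl ?fsubsetUr ?msuppD_le //.
by rewrite -big_split /=; apply: eq_bigr => m _; rewrite mcoeffD scalerDr.
Qed.

Lemma vpeval_sum (I : Type) (r : seq I) (P : pred I)
    (F : I -> {malg B['X_{1..p}]}) t :
  vpeval (\sum_(i <- r | P i) F i) t = \sum_(i <- r | P i) vpeval (F i) t.
Proof.
by apply: (big_morph (fun f => vpeval f t)) => [f g|];
  rewrite ?vpevalD ?vpeval0.
Qed.

Lemma vpevalU m b t :
  vpeval (mkmalgU m b : {malg B['X_{1..p}]}) t =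
  (\prod_(k < p) t`_k ^+ m k)%:C *: b.
Proof.
by rewrite (vpeval_supp _ (d := fset1 m)) ?msuppU_le // big_seq_fset1 mcoeffUU.
Qed.

Lemma eq_vpeval f t1 t2 : (forall k : 'I_p, t1`_k = t2`_k) ->
  vpeval f t1 = vpeval f t2.
Proof.
move=> e; apply: eq_bigr => m _; congr (real_complex R _ *: _).
by apply: eq_bigr => k _; rewrite e.
Qed.

Lemma vpeval_polyfun f (T : R -> seq R) :
  (forall k : 'I_p, exists q : {poly R}, forall s, (T s)`_k = q.[s]) ->
  exists g', polyfun_deriv (fun s => vpeval f (T s)) g'.
Proof.
move=> /fin_all_exists[q Tq].
pose L : seq ({poly R} * B) :=
  [seq (\prod_(k < p) q k ^+ m k, mcoeff m f) | m : 'X_{1..p} <- msupp f].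
exists (fun s => \sum_(z <- L) (z.1^`().[s])%:C *: z.2); exists L.
split=> // s; rewrite big_map; apply: eq_bigr => m _ /=.
congr (real_complex R _ *: _); rewrite horner_prod; apply: eq_bigr => k _.
by rewrite horner_exp Tq.
Qed.

(** The formal partial derivative is the derivative along one coordinate.  The
    shift [a] covers the dependence of (.., u + v, ..) on one summand. *)
Lemma vpeval_deriv f (j : 'I_p) (a : R) (t : seq R) :
  polyfun_deriv (fun s => vpeval f (set_nth 0 t j (s + a)))
    (fun s => vpeval (vpderiv j f) (set_nth 0 t j (s + a))).
Proof.
exists [seq (('X + a%:P) ^+ m j * (\prod_(k < p | k != j) t`_k ^+ m k)%:P,
  mcoeff m f) | m : 'X_{1..p} <- msupp f].
split=> s; rewrite big_map /=.
  apply: eq_bigr => m _; congr (real_complex R _ *: _).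
  rewrite (bigD1 j) //= nth_set_nth /= eqxx !hornerE; congr (_ * _).
  apply: eq_bigr => k kj; rewrite nth_set_nth /=.
  by rewrite -[(_ == _ :> nat)]/(k == j) (negbTE kj).
rewrite vpeval_sum; apply: eq_bigr => m _; rewrite vpevalU.
rewrite (bigD1 j) //= nth_set_nth /= eqxx divcmE ucmE eqxx.
rewrite derivM derivC mulr0 addr0 deriv_exp derivD derivX derivC addr0 mul1r.
rewrite -scaler_nat -(rmorph_nat (real_complex R)) scalerA -rmorphM.
congr (real_complex R _ *: _).
rewrite hornerM hornerMn hornerC horner_exp !hornerE subn1.
rewrite mulrC mulr_natl -mulrnAl; congr (_ *+ _ * _).
apply: eq_bigr => k kj; rewrite nth_set_nth /= divcmE ucmE.
by rewrite -[(_ == _ :> nat)]/(k == j) [j == k]eq_sym (negbTE kj) subn0.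
Qed.
End Evaluation.
End VectorPolynomialFunctions.

(** * Discrete antiderivatives and polynomiality *)
Section NewtonForm.
Variables (R : realType) (B : lmodType R[i]) (p : nat).
Local Notation "r %:C" := (real_complex R r).
Implicit Types (F : (nat -> nat) -> B).

(** Polynomials in the basis of products of binomial coefficients, in which
    discrete summation only raises one lower index. *)
Definition newton_form F : Prop :=
  exists L : seq ((nat -> nat) * B), forall N,
    F N = \sum_(z <- L) z.2 *+ \prod_(x < p) 'C(N x, z.1 x).

Lemma newton_form_ext F1 F2 : F1 =1 F2 -> newton_form F1 -> newton_form F2.
Proof. by move=> e [L h]; exists L => N; rewrite -e h. Qed.

Lemma newton_form_cst (b : B) : newton_form (fun=> b).
Proof.
exists [:: (fun=> 0%N, b)] => N; rewrite big_seq1 /= big1 ?mulr1n // => x _.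
by rewrite bin0.
Qed.

Lemma newton_form_sum (I : Type) (r : seq I) (P : pred I)
    (F : I -> (nat -> nat) -> B) :
  (forall i, P i -> newton_form (F i)) ->
  newton_form (fun N => \sum_(i <- r | P i) F i N).
Proof.
move=> h; elim: r => [|x r [L hL]].
  by apply: newton_form_ext (newton_form_cst 0) => N; rewrite big_nil.
case Px: (P x); last by exists L => N; rewrite big_cons Px hL.
have [K hK] := h x Px; exists (K ++ L) => N.
by rewrite big_cons Px big_cat /= hK hL.
Qed.

(** By Pascal's rule, raising the lower index of variable [j] in every term of
    the increment gives a function with that increment which vanishes at
    N_j = 0; induction on N_j identifies it with [F]. *)
Lemma newton_form_antidiff F (j : 'I_p) :
  (forall N, F (upd N j 0%N) = 0) ->
  newton_form (fun N => F (upd N j (N j).+1) - F N) -> newton_form F.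
Proof.
move=> F0 [L hL]; exists [seq (upd z.1 j (z.1 j).+1, z.2) | z <- L] => N.
have updE (v : nat) (r : nat -> nat) :
    (\prod_(x < p) 'C(upd N j v x, r x) =
     'C(v, r j) * \prod_(x < p | x != j) 'C(N x, r x))%N.
  rewrite (bigD1 j) //= {1}/upd eqxx; congr (_ * _)%N.
  apply: eq_bigr => x xj; rewrite /upd.
  by rewrite -[(_ == _ :> nat)]/(x == j) (negbTE xj).
have updr (z : nat -> nat) :
    (\prod_(x < p | x != j) 'C(N x, upd z j (z j).+1 x) =
     \prod_(x < p | x != j) 'C(N x, z x))%N.
  apply: eq_bigr => x xj; rewrite /upd.
  by rewrite -[(_ == _ :> nat)]/(x == j) (negbTE xj).
have updj (T : Type) (e : nat -> T) v : upd e j v j = v by rewrite /upd eqxx.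
rewrite -[in F N](upd_id N j) -[in RHS](upd_id N j).
elim: (N j) => [|v IH]; rewrite big_map /=.
  rewrite F0 big1 // => z _; rewrite updE updj bin0n /= mul0n mulr0n //.
have /= := hL (upd N j v); rewrite updj => /eqP; rewrite subr_eq => /eqP.
have -> : upd (upd N j v) j v.+1 = upd N j v.+1.
  by apply: boolp.funext => x; rewrite /upd; case: eqP.
move=> ->; rewrite IH big_map -big_split /=; apply: eq_bigr => z _.
by rewrite !updE !updj !updr binS mulnDl mulrnDr addrC.
Qed.

Lemma binomial_poly r :
  exists q : {poly R}, forall m : nat, q.[m%:R] = 'C(m, r)%:R.
Proof.
elim: r => [|r [q hq]]; first by exists 1 => m; rewrite hornerC bin0.
exists (r.+1%:R^-1 *: (q * ('X - r%:R%:P))) => m.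
rewrite hornerZ hornerM hq hornerXsubC.
have r0 : r.+1%:R != 0 :> R by rewrite pnatr_eq0.
apply: (mulfI r0); rewrite mulVKf // -natrM mul_bin_left mulnC natrM.
have [le|lt] := leqP r m; first by rewrite natrB.
by rewrite bin_small ?mul0r.
Qed.

Lemma vpeval_prod (q : 'I_p -> {poly R}) (b : B) :
  exists f : {malg B['X_{1..p}]}, forall t : seq R,
    vpeval f t = (\prod_(k < p) (q k).[t`_k])%:C *: b.
Proof.
pose D := \max_(k < p) size (q k).
have qD k : (size (q k) <= D)%N by exact: leq_bigmax.
pose mon (i : {ffun 'I_p -> 'I_D}) : 'X_{1..p} :=
  [cmonom i k : nat | k in [fset k in 'I_p]]%M.
have monE i k : mon i k = i k :> nat by rewrite cmE fsfun_fun !inE.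
exists (\sum_(i : {ffun 'I_p -> 'I_D})
  mkmalgU (mon i) ((\prod_k (q k)`_(i k))%:C *: b)) => t.
rewrite vpeval_sum.
under [X in real_complex R X]eq_bigr => k _ do
  rewrite (horner_coef_wide _ (qD k)).
rewrite bigA_distr_bigA rmorph_sum /= scaler_suml; apply: eq_bigr => i _.
rewrite vpevalU scalerA -rmorphM big_split mulrC /=.
by congr (real_complex R (_ * _) *: b); apply: eq_bigr => k _; rewrite monE.
Qed.

Lemma newton_form_vpeval F : newton_form F ->
  exists f : {malg B['X_{1..p}]}, forall N : p.-tuple nat,
    vpeval f [seq m%:R | m <- N] = F (nth 0%N N).
Proof.
move=> [L hL].
suff [f hf] : exists f : {malg B['X_{1..p}]}, forall N : p.-tuple nat,
    vpeval f [seq m%:R | m <- N] =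
    \sum_(z <- L) z.2 *+ \prod_(x < p) 'C(nth 0%N N x, z.1 x).
  by exists f => N; rewrite hf hL.
elim: L {hL} => [|z L [f hf]].
  by exists 0 => N; rewrite vpeval0 big_nil.
have /fin_all_exists[q hq] := fun k : 'I_p => binomial_poly (z.1 k).
have [g hg] := vpeval_prod q z.2.
exists (g + f) => N; rewrite vpevalD hf big_cons hg; congr (_ + _).
rewrite -scaler_nat -(rmorph_nat (real_complex R)) natr_prod.
congr (real_complex R _ *: _); apply: eq_bigr => k _.
by rewrite (nth_map 0%N) ?size_tuple // hq.
Qed.

End NewtonForm.

(** * Ordered set partitions as order patterns *)
Section Places.
Variable n : nat.
Implicit Types (tau pi sigma : seq {set 'I_n}) (r : rel 'I_n) (b : 'I_n -> nat).

Definition before r (P Q : {set 'I_n}) : bool :=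
  [forall k in P, forall l in Q, r k l].

Lemma beforeP r (P Q : {set 'I_n}) :
  reflect (forall k l, k \in P -> l \in Q -> r k l) (before r P Q).
Proof.
apply: (iffP forall_inP) => [h k l kP lQ|h k kP].
  by have /forall_inP := h k kP; apply.
by apply/forall_inP => l; apply: h.
Qed.

(** Two conditions pin down the comparison of block indices: blocks are listed
    compatibly with [r], and [r] relates no two elements of a block.  This
    avoids an explicit formula for the indices in a quasi-meet. *)
Lemma block_index_order r tau :
  (forall k l, r k l -> ~~ r l k) ->
  (forall k, has (fun P : {set 'I_n} => k \in P) tau) ->
  pairwise (before r) tau ->
  (forall P k l, P \in tau -> k \in P -> l \in P -> ~~ r k l) ->
  forall k l, (block_index tau k < block_index tau l)%N = r k l.
Proof.
move=> asym cov /(pairwiseP set0) pw cst.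
have bs k : (block_index tau k < size tau)%N by rewrite -has_find.
have kb k : k \in nth set0 tau (block_index tau k).
  by have := nth_find set0 (cov k).
have lt k l : (block_index tau k < block_index tau l)%N -> r k l.
  by move=> kl; apply: (beforeP r _ _ (pw _ _ (bs k) (bs l) kl)).
move=> k l; case: ltngtP => [/lt->//|/lt/asym/negbTE->//|e].
by apply/esym/negbTE/(cst (nth set0 tau (block_index tau k)));
  rewrite ?mem_nth ?kb // e kb.
Qed.

Lemma block_index_eq tau b :
  (forall k, (b k < size tau)%N) ->
  (forall x, (x < size tau)%N -> nth set0 tau x = [set k | b k == x]) ->
  block_index tau =1 b.
Proof.
move=> bs tauE k; rewrite /block_index.
have bk : k \in nth set0 tau (b k) by rewrite tauE // inE.
have hk : has (fun P : {set 'I_n} => k \in P) tau.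
  by apply/(has_nthP set0); exists (b k).
have := nth_find set0 hk; rewrite tauE -?has_find // inE => /eqP->.
by [].
Qed.

(** Disjointness and covering both follow from the blocks being the level sets
    of a single function. *)
Lemma osp_of_places tau b :
  set0 \notin tau -> (forall k, (b k < size tau)%N) ->
  (forall x, (x < size tau)%N -> nth set0 tau x = [set k | b k == x]) ->
  ordered_set_partition tau.
Proof.
move=> tau0 bs tauE; apply/and3P; split=> //.
  apply/(pairwiseP set0) => x y xs ys xy; rewrite !tauE //.
  rewrite disjoint_subset; apply/subsetP => k; rewrite !inE => /eqP->.
  by rewrite ltn_eqF.
apply/eqP/setP => k; rewrite inE.
have : nth set0 tau (b k) \in tau by rewrite mem_nth.
by move=> h; rewrite (big_rem _ h) /= tauE // !inE eqxx.
Qed.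

Section Osp.
Variables (pi : seq {set 'I_n}) (hpi : ordered_set_partition pi).

Lemma osp_has k : has (fun P : {set 'I_n} => k \in P) pi.
Proof.
have /and3P[_ _ /eqP/setP/(_ k)] := hpi; rewrite inE => h.
apply/hasP; move: h; elim: pi => [|P s IH]; first by rewrite big_nil inE.
rewrite big_cons inE => /orP[kP|/IH[Q Qs kQ]].
  by exists P; rewrite ?mem_head.
by exists Q; rewrite // in_cons Qs orbT.
Qed.

Lemma block_index_size k : (block_index pi k < size pi)%N.
Proof. by rewrite -has_find osp_has. Qed.

Lemma nth_block x : (x < size pi)%N ->
  nth set0 pi x = [set k | block_index pi k == x].
Proof.
move=> xs; apply/setP => k; rewrite inE.
have /and3P[_ /(pairwiseP set0) pw _] := hpi.
have kb := nth_find set0 (osp_has k); rewrite -/(block_index pi k) in kb.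
apply/idP/eqP => [kx|<-//].
have bs := block_index_size k.
have dis u v : (u < size pi)%N -> (v < size pi)%N -> (u < v)%N ->
    k \in nth set0 pi u -> k \in nth set0 pi v -> False.
  move=> us vs uv ku kv; have := pw u v us vs uv.
  by rewrite disjoint_subset => /subsetP/(_ k ku); rewrite inE kv.
case: (ltngtP (block_index pi k) x) => // lt.
  by case: (dis _ _ bs xs lt kb kx).
by case: (dis _ _ xs bs lt kx kb).
Qed.

Lemma osp_before :
  pairwise (before (fun k l => block_index pi k < block_index pi l)%N) pi.
Proof.
apply/(pairwiseP set0) => x y xs ys xy; apply/beforeP => k l.
by rewrite !nth_block // !inE => /eqP-> /eqP->.
Qed.

Lemma osp_block_index_const P k l : P \in pi -> k \in P -> l \in P ->
  block_index pi k = block_index pi l.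
Proof.
move=> /(nthP set0)[x xs <-]; rewrite nth_block // !inE.
by move=> /eqP-> /eqP->.
Qed.

End Osp.

Lemma ordered_kernel_before (i : 'I_n -> nat) :
  pairwise (before (fun k l => i k < i l)%N) (ordered_kernel i).
Proof.
rewrite pairwise_map.
have : sorted ltn (sort leq (undup (codom i))).
  by rewrite ltn_sorted_uniq_leq sort_uniq undup_uniq sort_sorted //;
    apply: leq_total.
rewrite sorted_pairwise; last exact: ltn_trans.
apply: sub_pairwise => u v uv; apply/beforeP => k l.
by rewrite !inE => /eqP-> /eqP->.
Qed.

Definition lex b (i : 'I_n -> nat) : rel 'I_n :=
  fun k l => (b k < b l)%N || (b k == b l) && (i k < i l)%N.

Lemma pairwise_meet b (i : 'I_n -> nat) pi sigma :
  pairwise (before (fun k l => b k < b l)%N) pi ->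
  (forall P k l, P \in pi -> k \in P -> l \in P -> b k = b l) ->
  pairwise (before (fun k l => i k < i l)%N) sigma ->
  pairwise (before (lex b i)) [seq P :&: Q | P <- pi, Q <- sigma].
Proof.
elim: pi => [//|P pi IH] /=; rewrite pairwise_cat => /andP[Ppi pwpi] cst pws.
rewrite IH // => [|Q k l Qpi]; last by apply: cst; rewrite in_cons Qpi orbT.
rewrite andbT; apply/andP; split.
  apply/allrelP => _ _ /mapP[Q Qs ->] /allpairsP[[P' Q'] /= [P'pi _ ->]].
  apply/beforeP => k l; rewrite !inE => /andP[kP _] /andP[lP' _].
  have /allP/(_ P' P'pi)/beforeP/(_ k l kP lP') := Ppi.
  by rewrite /lex => ->.
rewrite pairwise_map; apply: sub_pairwise pws => Q Q' /beforeP QQ'.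
apply/beforeP => k l; rewrite !inE => /andP[kP kQ] /andP[lP lQ'].
by rewrite /lex QQ' // (cst P k l) ?mem_head // eqxx orbT.
Qed.

(** The quasi-meet lists its blocks lexicographically, and the removal of empty
    intersections changes no comparison. *)
Lemma block_index_meet pi (i : 'I_n -> nat) :
  ordered_set_partition pi -> forall k l,
  (block_index (quasi_meet pi (ordered_kernel i)) k <
   block_index (quasi_meet pi (ordered_kernel i)) l)%N =
  lex (block_index pi) i k l.
Proof.
move=> hpi; apply: block_index_order.
- move=> k l; rewrite /lex; case: ltngtP => //= _; by case: ltngtP.
- move=> k; have /hasP[P Ppi kP] := osp_has hpi k.
  have /hasP[Q Qs kQ] := osp_has (ordered_kernel_osp i) k.
  apply/hasP; exists (P :&: Q); last by rewrite inE kP.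
  rewrite mem_filter; apply/andP; split; last exact: allpairs_f.
  by apply/set0Pn; exists k; rewrite inE kP.
- apply: (subseq_pairwise (filter_subseq _ _)); apply: pairwise_meet.
  + exact: osp_before.
  + exact: osp_block_index_const.
  + exact: ordered_kernel_before.
- move=> D k l; rewrite mem_filter => /andP[_].
  move=> /allpairsP[[P Q] /= [Ppi /mapP[v _ ->] ->]].
  rewrite !inE => /andP[kP /eqP ik] /andP[lP /eqP il].
  by rewrite /lex ik il (osp_block_index_const hpi Ppi kP lP) !ltnn andbF.
Qed.

End Places.

(** * Consecutive intervals, and cutting one of them in two *)
Lemma eqn_of_ltn (x y x' y' : nat) :
  (x < y)%N = (x' < y')%N -> (y < x)%N = (y' < x')%N -> (x == y) = (x' == y').
Proof. by case: (ltngtP x y); case: (ltngtP x' y'). Qed.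

Definition partial_sum (N : nat -> nat) (x : nat) : nat := (\sum_(y < x) N y)%N.

Lemma partial_sumS N x : partial_sum N x.+1 = (partial_sum N x + N x)%N.
Proof. by rewrite /partial_sum big_ord_recr. Qed.

Lemma leq_partial_sum N x y : (x <= y)%N ->
  (partial_sum N x <= partial_sum N y)%N.
Proof.
move=> /subnKC<-; elim: (y - x)%N => [|d IH]; first by rewrite addn0.
by rewrite addnS partial_sumS (leq_trans IH) ?leq_addr.
Qed.

(** Points in consecutive intervals compare first by interval, then by offset
    within the interval. *)
Lemma partial_sum_lex N x y a a' : (a < N x)%N -> (a' < N y)%N ->
  (partial_sum N x + a < partial_sum N y + a')%N =
  (x < y)%N || (x == y) && (a < a')%N.
Proof.
move=> aN a'N.
have lt u v c c' : (c < N u)%N -> (u < v)%N ->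
    (partial_sum N u + c < partial_sum N v + c')%N.
  move=> cu uv; apply: (@leq_trans (partial_sum N v)); last exact: leq_addr.
  apply: leq_trans (leq_partial_sum N uv).
  by rewrite partial_sumS ltn_add2l.
case: (ltngtP x y) aN => [xy|yx|->] aN /=; first by rewrite lt.
  by apply/negbTE; rewrite -leqNgt ltnW // lt.
by rewrite ltn_add2l.
Qed.

(** The list N with its entry at [x] replaced by the two entries [u], [v]; the
    old positions other than [x] move along [bump x]. *)
Definition insert_split (T : Type) (N : nat -> T) (x : nat) (u v : T) :
    nat -> T :=
  fun y => if (y < x)%N then N y else if y == x then u
           else if y == x.+1 then v else N y.-1.

Lemma insert_split_bump T (N : nat -> T) x u v y :
  insert_split N x u v (bump x y) = if y == x then v else N y.
Proof.
rewrite /insert_split /bump; case: (ltngtP x y) => [xy|yx|<-] /=.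
- by rewrite ltnNge leqW 1?ltnW //= !gtn_eqF // ltnW.
- by rewrite add0n yx.
- by rewrite ltnNge leqnSn /= add1n gtn_eqF // eqxx.
Qed.

Lemma insert_split_at T (N : nat -> T) x u v : insert_split N x u v x = u.
Proof. by rewrite /insert_split ltnn eqxx. Qed.

Lemma partial_sum_insert_at N x u v :
  partial_sum (insert_split N x u v) x = partial_sum N x.
Proof. by apply: eq_bigr => y _; rewrite /insert_split ltn_ord. Qed.

(** Cutting the interval at [x] into lengths [u] and [v] moves no interval; the
    upper part, at position x + 1, starts [u] later than the original one. *)
Lemma partial_sum_insert N x u v y :
  partial_sum (insert_split N x u v) (bump x y) =
  (partial_sum (upd N x (u + v)) y + (if y == x then u else 0))%N.
Proof.
have below z : (z <= x)%N -> partial_sum (insert_split N x u v) z =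
    partial_sum (upd N x (u + v)) z.
  move=> zx; apply: eq_bigr => w _; have wx := leq_trans (ltn_ord w) zx.
  by rewrite /insert_split /upd wx ltn_eqF.
have [yx|xy] := ltnP y x.
  by rewrite /bump leqNgt yx ltn_eqF // addn0 add0n below // ltnW.
have at_x : partial_sum (insert_split N x u v) x.+1 =
    (partial_sum (upd N x (u + v)) x + u)%N.
  by rewrite partial_sumS below // insert_split_at.
rewrite /bump xy add1n; move: xy => /subnKC<-.
elim: (y - x)%N => [|d IH]; first by rewrite addn0 eqxx at_x.
rewrite addnS partial_sumS IH [in RHS]partial_sumS.
have := insert_split_bump N x u v (x + d); rewrite /bump leq_addr add1n => ->.
rewrite [in RHS]gtn_eqF ?ltnS ?leq_addr // addn0 /upd.
by case: eqP => _; rewrite ?addn0 // addnA.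
Qed.

(** The places of elements after the elements at place [x] have been divided
    into [Q], which stays at [x], and the rest, which goes to place x + 1. *)
Definition split_place n (b : 'I_n -> nat) (x : nat) (Q : {set 'I_n}) :
    'I_n -> nat :=
  fun k => if k \in Q then x else bump x (b k).

(** * Sums of moments over interval-constrained colourings *)
Section IntervalMoments.
Variables (R : realType) (A B : assocAlgType R[i]) (phi : {linear A -> B}).
Variables (S : spreadability_system phi) (n : nat) (X : 'I_n -> A).

(** Spreadability in invariant form.  The order-preserving relabelling required
    by the axiom is recovered from the two index families by choosing for each
    value an element that carries it. *)
Lemma moment_order (c c' : 'I_n -> nat) :
  (forall k l, (c k < c l)%N = (c' k < c' l)%N) -> moment S c X = moment S c' X.
Proof.
move=> e.
have ee k l : (c k == c l) = (c' k == c' l) by apply: eqn_of_ltn.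
pose h v := if [pick k | c k == v] is Some k then c' k else 0%N.
have hE k : h (c k) = c' k.
  rewrite /h; case: pickP => [l|/(_ k)]; last by rewrite eqxx.
  by rewrite ee => /eqP.
rewrite /moment (@ss_spread _ _ _ _ S n X c h).
  by congr (ss_phi S (aprod _)); apply: eq_map => k; rewrite hE.
by move=> k l; rewrite !hE e.
Qed.

(** Colourings are indexed by their offsets within the intervals, so that moving
    the intervals without changing their order leaves the index set alone. *)
Definition interval_moment (M lo : 'I_n -> nat) : B :=
  \sum_(i : {dffun forall k : 'I_n, 'I_(M k)})
     moment S (fun k => lo k + i k)%N X.

Lemma interval_moment_order (M M' lo lo' : 'I_n -> nat) :
  M =1 M' ->
  (forall k l a a', (a < M k)%N -> (a' < M l)%N ->
    (lo k + a < lo l + a')%N = (lo' k + a < lo' l + a')%N) ->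
  interval_moment M lo = interval_moment M' lo'.
Proof.
move=> /boolp.funext <- e; apply: eq_bigr => i _.
by apply: moment_order => k l; rewrite e.
Qed.

(** With a common codomain the constraint on a colouring becomes a predicate, so
    that colourings with different interval lengths can be regrouped. *)
Lemma interval_momentE (T : nat) (M lo : 'I_n -> nat) :
  (forall k, lo k + M k <= T)%N ->
  interval_moment M lo =
  \sum_(c : {ffun 'I_n -> 'I_T} | [forall k, (lo k <= c k < lo k + M k)%N])
     moment S (fun k => c k) X.
Proof.
move=> hT.
have cT (i : {dffun forall k : 'I_n, 'I_(M k)}) k : (lo k + i k < T)%N.
  by apply: leq_trans (hT k); rewrite ltn_add2l.
pose h (i : {dffun forall k : 'I_n, 'I_(M k)}) : {ffun 'I_n -> 'I_T} :=
  [ffun k => Ordinal (cT i k)].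
have hI : injective h.
  move=> i i' /ffunP e; apply/ffunP => k; apply/val_inj/eqP.
  by have /(congr1 val)/eqP := e k; rewrite !ffunE /= eqn_add2l.
rewrite (eq_bigl (mem (h @: setT))) => [|c].
  rewrite big_imset /=; last by move=> i i' _ _; apply: hI.
  rewrite (eq_bigl xpredT) => [|i]; last by rewrite inE.
  apply: eq_bigr => i _.
  by apply: moment_order => k l; rewrite !ffunE.
apply/forallP/imsetP => [hc|[i _ ->] k]; last first.
  by rewrite ffunE /= leq_addr ltn_add2l ltn_ord.
have pf k : (c k - lo k < M k)%N.
  by have /andP[le lt] := hc k; rewrite -(ltn_add2l (lo k)) subnKC.
exists (finfun (fun k => Ordinal (pf k))) => //.
apply/ffunP => k; apply/val_inj; rewrite !ffunE /= ffunE /= subnKC //.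
by have /andP[] := hc k.
Qed.

(** The summand of [Q] collects the colourings for which [Q] is the set of
    elements of [P] coloured in the lower part, of length [u], of their
    interval. *)
Lemma interval_moment_split (P : {set 'I_n}) (u v : nat) (M lo : 'I_n -> nat) :
  interval_moment (fun k => if k \in P then (u + v)%N else M k) lo =
  \sum_(Q : {set 'I_n} | Q \subset P)
     interval_moment
       (fun k => if k \in Q then u else if k \in P then v else M k)
       (fun k => if k \in P :\: Q then (lo k + u)%N else lo k).
Proof.
pose T := (\max_k (lo k + (u + v) + M k))%N.
have hT k : (lo k + (u + v) + M k <= T)%N by exact: leq_bigmax.
rewrite (interval_momentE (T := T)) => [|k]; last first.
  by apply: leq_trans (hT k); case: ifP => _; rewrite ?leq_addr // -addnA
    leq_add2l leq_addl.
pose low (c : {ffun 'I_n -> 'I_T}) := [set k in P | (c k < lo k + u)%N].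
rewrite (partition_big low (fun Q => Q \subset P)) => [|c _]; last first.
  by apply/subsetP => k; rewrite inE => /andP[].
apply: eq_bigr => Q QP; rewrite (interval_momentE (T := T)) => [|k]; last first.
  apply: leq_trans (hT k); rewrite inE.
  case kQ: (k \in Q).
    by rewrite (subsetP QP) //= -!addnA leq_add2l leq_addr.
  by case: (k \in P) => /=; rewrite -!addnA leq_add2l ?leq_add2l ?leq_addr //
    addnA leq_addl.
apply: eq_bigl => c; apply/andP/forallP => [[/forallP hc /eqP Qc] k|hc].
  have := hc k; rewrite -Qc !inE.
  case kP: (k \in P) => //=; rewrite andbT.
  case: (ltnP (c k) (lo k + u)%N) => [lt|le'] /andP[le lt'] /=.
    by rewrite le lt.
  by rewrite le' -addnA.
split.
  apply/forallP => k; have := hc k; rewrite !inE.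
  case kQ: (k \in Q) => /=.
    rewrite (subsetP QP) //= => /andP[-> lt].
    by rewrite (leq_trans lt) // leq_add2l leq_addr.
  case: (k \in P) => //= /andP[le lt].
  by rewrite (leq_trans _ le) ?leq_addr //= addnA.
apply/eqP/setP => k; have := hc k; rewrite !inE.
case kQ: (k \in Q) => /=; first by rewrite (subsetP QP) //= => /andP[_ ->].
by case: (k \in P) => //= /andP[le _]; rewrite ltnNge le.
Qed.

(** The intervals are consecutive of lengths N 0, N 1, .., and [b k] is the
    number of the one in which [k] is coloured. *)
Definition placed_moment (b : 'I_n -> nat) (N : nat -> nat) : B :=
  interval_moment (fun k => N (b k)) (fun k => partial_sum N (b k)).

Lemma placed_moment_order (b b' : 'I_n -> nat) (N N' : nat -> nat) :
  (forall k, N (b k) = N' (b' k)) ->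
  (forall k l, (b k < b l)%N = (b' k < b' l)%N) ->
  placed_moment b N = placed_moment b' N'.
Proof.
move=> eN eb; apply: interval_moment_order => // k l a a' ak al.
rewrite !partial_sum_lex -?eN // eb; congr (_ || _ && _).
exact: eqn_of_ltn.
Qed.

Lemma placed_moment_split (b : 'I_n -> nat) (N : nat -> nat) x u v :
  placed_moment b (upd N x (u + v)%N) =
  \sum_(Q : {set 'I_n} | Q \subset [set k | b k == x])
    placed_moment (split_place b x Q) (insert_split N x u v).
Proof.
set P := [set k | b k == x].
have := @interval_moment_split P u v (fun k => N (b k))
  (fun k => partial_sum (upd N x (u + v)) (b k)).
have -> : (fun k => if k \in P then (u + v)%N else N (b k)) =
    (fun k => upd N x (u + v)%N (b k)).
  by apply: boolp.funext => k; rewrite inE.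
move=> h; apply: etrans h _.
apply: eq_bigr => Q QP; congr interval_moment; apply: boolp.funext => k;
  rewrite /split_place !inE; case kQ: (k \in Q) => /=.
- by rewrite insert_split_at.
- by rewrite insert_split_bump.
- rewrite partial_sum_insert_at; have := subsetP QP _ kQ; rewrite inE => /eqP->.
  by apply: eq_bigr => y _; rewrite /upd ltn_eqF.
- by rewrite partial_sum_insert; case: eqP => _; rewrite ?addn0.
Qed.

(** An interval in which no element is coloured can be dropped, since only the
    order of the colours matters; this is the omission of an empty block
    together with its parameter. *)
Lemma placed_moment_empty (b : 'I_n -> nat) (N : nat -> nat) x u v :
  placed_moment (split_place b x set0) (insert_split N x u v) =
  placed_moment b (upd N x v).
Proof.
apply: placed_moment_order => [k|k l]; rewrite /split_place !inE.
  by rewrite insert_split_bump /upd.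
by rewrite !ltnNge leq_bump2.
Qed.

Lemma placed_moment_full (b : 'I_n -> nat) (N : nat -> nat) x u v :
  placed_moment (split_place b x [set k | b k == x]) (insert_split N x u v) =
  placed_moment b (upd N x u).
Proof.
have sE k : split_place b x [set k | b k == x] k = bump x.+1 (b k).
  by rewrite /split_place inE /bump; case: ltngtP => //= ->.
apply: placed_moment_order => [k|k l]; last by rewrite !sE !ltnNge leq_bump2.
rewrite /split_place inE /upd; case: eqP => [_|/eqP h].
  by rewrite insert_split_at.
by rewrite insert_split_bump (negbTE h).
Qed.

(** Polynomiality in the interval lengths.  Each interval has either length 1 or
    a variable of its own as length, as prescribed by [w].  If one more colour
    is added at the bottom of an interval of variable length, the increment is
    the sum over the nonempty sets [Q] of elements that use the new colour, and
    these elements then sit in an interval of length 1.  So the number of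
    elements in intervals of variable length decreases. *)
Lemma newton_form_placed_moment p (b : 'I_n -> nat) (w : nat -> option 'I_p) :
  (forall x y, w x -> w x = w y -> x = y) ->
  newton_form p (fun N : nat -> nat => placed_moment b
    (fun x => if w x is Some y then N y else 1%N)).
Proof.
have [d] := ubnP #|[set k | isSome (w (b k))]|.
elim: d b w => // d IH b w; rewrite ltnS => sd wI.
pose V (N : nat -> nat) (x : nat) := if w x is Some y then N y else 1%N.
change (newton_form p (fun N => placed_moment b (V N))).
case: (set_0Vmem [set k | isSome (w (b k))]) => [w0|[k0]].
  apply: newton_form_ext (newton_form_cst p (placed_moment b (fun=> 1%N))) => N.
  apply: placed_moment_order => // k; rewrite /V.
  by have /setP/(_ k) := w0; rewrite !inE; case: (w (b k)).
rewrite inE; case wk0: (w (b k0)) => [y|] // _.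
set x := b k0 in wk0.
have Vupd N s : V (upd N y s) = upd (V N) x s.
  apply: boolp.funext => z; rewrite /V [in RHS]/upd.
  case: (eqVneq z x) => [->|zx]; first by rewrite wk0 /upd eqxx.
  case wz: (w z) => [y'|] //; rewrite /upd.
  case: eqP => // e; case/eqP: zx; apply: wI; rewrite wz // wk0.
  by congr Some; apply: val_inj.
apply: (newton_form_antidiff (j := y)) => [N|].
  (* [k0] has no colour available when its interval is empty. *)
  rewrite Vupd /placed_moment /interval_moment big1 // => i _.
  by case: (i k0) => a; rewrite /upd -/x eqxx ltn0.
pose P := [set k | b k == x].
apply: (newton_form_ext (F1 := fun N =>
   \sum_(Q : {set 'I_n} | (Q \subset P) && (Q != set0))
     placed_moment (split_place b x Q)
    (fun z => if insert_split w x None (w x) z is Some y' then N y' else 1%N))).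
  move=> N; rewrite Vupd.
  have -> : (N y).+1 = (1 + V N x)%N by rewrite /V wk0.
  rewrite placed_moment_split [in RHS](bigD1 set0) ?sub0set //=
    placed_moment_empty.
  rewrite upd_id addrAC subrr add0r; apply: eq_bigr => Q _; congr placed_moment.
  apply: boolp.funext => z; rewrite /insert_split.
  by case: ifP => //; case: ifP => //; case: ifP.
apply: newton_form_sum => Q /andP[QP /set0Pn[k1 k1Q]]; apply: IH.
  apply: leq_trans sd; apply: proper_card; apply/properP; split.
    apply/subsetP => k; rewrite !inE /split_place.
    case: ifP => _; first by rewrite insert_split_at.
    by rewrite insert_split_bump; case: eqP => [->|].
  exists k1; rewrite !inE /split_place ?k1Q ?insert_split_at //.
  by have := subsetP QP _ k1Q; rewrite inE => /eqP->; rewrite wk0.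
have wb z : insert_split w x None (w x) z -> exists2 z', z = bump x z' &
    insert_split w x None (w x) z = w z'.
  case: (eqVneq z x) => [->|zx]; first by rewrite insert_split_at.
  have zE : bump x (unbump x z) = z by rewrite unbumpKcond (negbTE zx).
  exists (unbump x z) => //; rewrite -[in LHS]zE insert_split_bump.
  by case: eqP => [->|].
move=> z1 z2 h1 e; have h2 := h1; rewrite e in h2.
have [z1' E1 e1] := wb _ h1; have [z2' E2 e2] := wb _ h2.
by rewrite E1 E2; congr bump; apply: wI; rewrite -e1 // e.
Qed.

(** Both sides run over the same colourings: a quasi-meet with an ordered kernel
    compares elements first by block and then by colour, as do the offsets in
    consecutive intervals. *)
Lemma phi_dot_placed (pi : seq {set 'I_n}) (N : nat -> nat) :
  ordered_set_partition pi ->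
  phi_dot S pi (fun k => N (block_index pi k)) X =
  placed_moment (block_index pi) N.
Proof.
move=> hpi; apply: eq_bigr => i _; apply: moment_order => k l.
by rewrite block_index_meet // partial_sum_lex.
Qed.

End IntervalMoments.

(** * Splitting a block of an ordered set partition *)
Lemma nth_insert_split (T : Type) (x0 : T) (s : seq T) (j : nat) (u v : T) x :
  (j < size s)%N ->
  nth x0 (take j s ++ [:: u; v] ++ drop j.+1 s) x =
  insert_split (nth x0 s) j u v x.
Proof.
move=> js; rewrite nth_cat size_take js /insert_split.
case: (ltngtP x j) => [xj|jx|->]; first by rewrite nth_take.
  rewrite -(subnKC jx) addSn -addnS addKn.
  case: (x - j.+1)%N => [|d] /=; first by rewrite addn1 eqxx.
  rewrite nth_drop !addnS eqSS -[X in _ == X]addn0 -addnS eqn_add2l /=.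
  by rewrite addSn addnS.
by rewrite subnn.
Qed.

Section SplitBlocks.
Variables (n : nat) (pi : seq {set 'I_n}) (hpi : ordered_set_partition pi).
Variables (j : 'I_(size pi)).
Local Notation P := (nth set0 pi j).

Lemma osp_index tau x : ordered_set_partition tau -> (x < size tau)%N ->
  index (nth set0 tau x : {set 'I_n}) tau = x.
Proof.
move=> htau xs; have Px := mem_nth set0 xs.
have /and3P[tau0 _ _] := htau.
have /set0Pn[k kx] : nth set0 tau x != set0.
  by apply: contraNneq tau0 => <-.
have xE y : (y < size tau)%N -> k \in nth set0 tau y -> block_index tau k = y.
  by move=> ys; rewrite nth_block // inE => /eqP.
by rewrite -(xE _ xs kx)
  (xE (index (nth set0 tau x) tau)) ?index_mem ?nth_index.
Qed.

Lemma split_front_full : split_front pi j P = pi.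
Proof. by rewrite /split_front eqxx /= -drop_nth // cat_take_drop. Qed.

Lemma split_back_full : split_back pi j P = pi.
Proof. by rewrite /split_back eqxx /= -drop_nth // cat_take_drop. Qed.

Section Proper.
Variable Q : {set 'I_n}.
Hypotheses (Q0 : Q != set0) (QP : Q \subset P) (nQP : Q != P).
Local Notation tau := (split_front pi j Q).

Lemma nth_split_front x :
  nth set0 tau x = insert_split (nth set0 pi) j Q (P :\: Q) x.
Proof. by rewrite /split_front (negbTE nQP) nth_insert_split. Qed.

Lemma size_split_front : size tau = (size pi).+1.
Proof.
rewrite /split_front (negbTE nQP) !size_cat size_take ltn_ord size_drop /=.
by rewrite !addnS -addSn subnKC.
Qed.

Lemma split_back_front : split_back pi j Q = split_front pi j (P :\: Q).
Proof.
rewrite /split_back /split_front (negbTE nQP) setDDr setDv set0U (setIidPr QP).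
case: eqP => // e; case/set0Pn: Q0 => k kQ.
by have := subsetP QP _ kQ; rewrite -e inE kQ.
Qed.

Lemma split_place_lt k : (split_place (block_index pi) j Q k < size tau)%N.
Proof.
rewrite size_split_front /split_place.
case: ifP => _; first exact: leqW (ltn_ord j).
have := block_index_size hpi k; rewrite /bump.
by case: (leqP j (block_index pi k)) => _ h /=; rewrite ?add1n ?add0n // leqW.
Qed.

Lemma nth_split_place x : (x < size tau)%N ->
  nth set0 tau x = [set k | split_place (block_index pi) j Q k == x].
Proof.
rewrite size_split_front nth_split_front ltnS => xs.
have bQ k : k \in Q -> block_index pi k = j.
  by move=> /(subsetP QP); rewrite nth_block // inE => /eqP.
apply/setP => k; rewrite inE /split_place.
case: (eqVneq x j) => [->|xj].
  rewrite insert_split_at; case: ifP => _; first by rewrite eqxx.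
  by rewrite eq_sym (negbTE (neq_bump _ _)).
have xE : bump j (unbump j x) = x by rewrite unbumpKcond (negbTE xj).
move: xs; rewrite -xE; set y := unbump j x => ys; rewrite insert_split_bump.
have bI : (bump j (block_index pi k) == bump j y) = (block_index pi k == y).
  by rewrite (inj_eq (can_inj (bumpK j))).
case: (eqVneq y j) => [yj|yj].
  rewrite inE nth_block // inE; case: ifP => /= kQ; last by rewrite bI yj.
  by rewrite (negbTE (neq_bump _ _)).
have ypi : (y < size pi)%N.
  move: ys yj; rewrite /bump; case: (ltngtP y j) => [yj|//|//] _ _.
  by rewrite (ltn_trans yj).
rewrite nth_block // inE; case: ifP => // kQ.
by rewrite (bQ _ kQ) eq_sym (negbTE yj) (negbTE (neq_bump _ _)).
Qed.

Lemma osp_split_front : ordered_set_partition tau.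
Proof.
apply: (osp_of_places (b := split_place (block_index pi) j Q)).
- have /and3P[pi0 _ _] := hpi.
  rewrite /split_front (negbTE nQP) !mem_cat !inE !negb_or ![set0 == _]eq_sym.
  rewrite Q0 setD_eq0 /=; apply/and3P; split=> //.
  + by apply: contra pi0; apply: mem_take.
  + by apply: contra nQP => PQ; rewrite eqEsubset QP.
  + by apply: contra pi0; apply: mem_drop.
- exact: split_place_lt.
- exact: nth_split_place.
Qed.

Lemma block_index_split_front :
  block_index tau =1 split_place (block_index pi) j Q.
Proof.
by apply: block_index_eq; [exact: split_place_lt | exact: nth_split_place].
Qed.

Lemma index_split_front : index Q tau = j.
Proof.
have e : nth set0 tau j = Q by rewrite nth_split_front insert_split_at.
by rewrite -[X in index X]e osp_index ?osp_split_front // size_split_front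
  ltnW // ltnS.
Qed.

Lemma index_split_front_rest : index (P :\: Q) tau = j.+1.
Proof.
have e : nth set0 tau j.+1 = P :\: Q.
  by rewrite nth_split_front /insert_split ltnNge leqnSn /= gtn_eqF // eqxx.
by rewrite -[X in index X]e osp_index ?osp_split_front // size_split_front ltnS.
Qed.

End Proper.
End SplitBlocks.

(** * The additivity formula and its derivatives *)
Section EvaluationOnFunctions.
Variables (R : realType) (B : lmodType R[i]) (p : nat).
Implicit Types (f : {malg B['X_{1..p}]}) (y : nat -> R).

Definition evalf f y : B := vpeval f (mkseq y p).

(** The partial derivative with respect to variable number [x], so that
    polynomials in [p] and in [p] + 1 variables are treated alike; it is 0 when
    there is no such variable. *)
Definition pderivf f (x : nat) y : B :=
  if insub x is Some k then evalf (vpderiv (k : 'I_p) f) y else 0.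

Lemma evalf_nth f (t : seq R) : evalf f (nth 0 t) = vpeval f t.
Proof. by apply: eq_vpeval => k; rewrite nth_mkseq. Qed.

Lemma evalf_deriv f (x : nat) y (a : R) :
  polyfun_deriv (fun s => evalf f (upd y x (s + a)))
    (fun s => pderivf f x (upd y x (s + a))).
Proof.
rewrite /pderivf; case: insubP => [k _ kx|xp].
  apply: polyfun_deriv_ext (vpeval_deriv f k a (mkseq y p)) => s;
  by apply: eq_vpeval => l; rewrite nth_set_nth /= !nth_mkseq // /upd kx.
apply: polyfun_deriv_ext (polyfun_deriv_cst (evalf f y)) => // s.
apply: eq_vpeval => l; rewrite !nth_mkseq // /upd ltn_eqF //.
by rewrite (leq_trans (ltn_ord l)) // leqNgt.
Qed.

Lemma evalf_polyfun f (c : R -> nat -> R) :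
  (forall k, exists q : {poly R}, forall s, c s k = q.[s]) ->
  exists g', polyfun_deriv (fun s => evalf f (c s)) g'.
Proof.
move=> h; apply: vpeval_polyfun => k; have [q hq] := h k.
by exists q => s; rewrite nth_mkseq.
Qed.

End EvaluationOnFunctions.

Section DerivativeFormula.
Variables (R : realType) (A B : assocAlgType R[i]) (phi : {linear A -> B}).
Variables (S : spreadability_system phi) (n : nat) (X : 'I_n -> A).

(** A polynomial with the prescribed values at positive integers exists, so the
    chosen one has them. *)
Lemma moment_polyP (pi : seq {set 'I_n}) : ordered_set_partition pi ->
  is_moment_poly S X (moment_poly S pi X).
Proof.
move=> hpi; apply: classical_sets.xgetPex.
pose w (x : nat) : option 'I_(size pi) := insub x.
have wI x y : w x -> w x = w y -> x = y.
  rewrite /w; case: insubP => // k _ <- _.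
  by case: insubP => // k' _ <- [->].
have [f hf] := newton_form_vpeval
  (newton_form_placed_moment S X (block_index pi) wI).
exists f => N _; rewrite hf (phi_dot_placed S X (nth 0%N N) hpi).
apply: placed_moment_order => // k; rewrite /w.
case: insubP => [l _ <- //|]; by rewrite block_index_size.
Qed.

Lemma evalf_moment_poly (pi : seq {set 'I_n}) (N : nat -> nat) (y : nat -> R) :
  ordered_set_partition pi -> (forall x, (0 < N x)%N) ->
  (forall x, y x = (N x)%:R) ->
  evalf (moment_poly S pi X) y = placed_moment S X (block_index pi) N.
Proof.
move=> hpi N0 yN; rewrite -phi_dot_placed //.
have := moment_polyP hpi (N := mktuple (fun k : 'I_(size pi) => N k)).
have nE x : (x < size pi)%N ->
    nth 0%N [tuple N (k : 'I_(size pi)) | k < size pi] x = N x.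
  by move=> xs; rewrite -[x in LHS]/(nat_of_ord (Ordinal xs)) nth_mktuple.
move=> h; apply: etrans (etrans (h _) _).
- apply: eq_vpeval => k; rewrite nth_mkseq //.
  by rewrite (nth_map 0%N) ?size_tuple // nE.
- by apply/allP => m /mapP[k _ ->].
- congr (phi_dot S pi _ X); apply: boolp.funext => k.
  by rewrite nE ?block_index_size.
Qed.

Lemma partial_cumulantE (pi : seq {set 'I_n}) (Q : {set 'I_n}) (t : seq R) x :
  index Q pi = x ->
  partial_cumulant S pi Q t X =
  pderivf (moment_poly S pi X) x (upd (nth 0 t) x 0).
Proof.
rewrite /partial_cumulant /pderivf => ->; case: insubP => // k _ kx.
by apply: eq_vpeval => l; rewrite nth_mkseq // nth_set_nth /= /upd kx.
Qed.

Variables (pi : seq {set 'I_n}) (hpi : ordered_set_partition pi).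
Variables (j : 'I_(size pi)).
Local Notation P := (nth set0 pi j).
Local Notation f := (moment_poly S pi X).

(** The summand of [Q] in the additivity formula.  For [Q] empty or equal to the
    whole block one of the two parts is dropped together with its
    parameter. *)
Definition split_moment (Q : {set 'I_n}) (y : nat -> R) (u v : R) : B :=
  if Q == set0 then evalf f (upd y j v)
  else if Q == P then evalf f (upd y j u)
  else evalf (moment_poly S (split_front pi j Q) X) (insert_split y j u v).

Lemma upd_natr (N : nat -> nat) x m z :
  upd (fun k => (N k)%:R : R) x m%:R z = (upd N x m z)%:R.
Proof. by rewrite /upd; case: ifP. Qed.

Lemma insert_split_natr (N : nat -> nat) x m m' z :
  insert_split (fun k => (N k)%:R : R) x m%:R m'%:R z =
  (insert_split N x m m' z)%:R.
Proof. by rewrite /insert_split; do 3?case: ifP. Qed.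

Lemma split_moment_nat (N : nat -> nat) (u v : nat) :
  (forall x, (0 < N x)%N) -> (0 < u)%N -> (0 < v)%N ->
  evalf f (upd (fun k => (N k)%:R) j (u%:R + v%:R)) =
  \sum_(Q : {set 'I_n} | Q \subset P)
    split_moment Q (fun k => (N k)%:R) u%:R v%:R.
Proof.
move=> N0 u0 v0.
have upd0 m : (0 < m)%N -> forall x, (0 < upd N j m x)%N.
  by move=> m0 x; rewrite /upd; case: ifP.
rewrite -natrD (evalf_moment_poly hpi (upd0 _ _) (upd_natr _ _ _))
  ?addn_gt0 ?u0 //.
rewrite placed_moment_split -nth_block //; apply: eq_bigr => Q QP.
rewrite /split_moment; case: eqP => [->|/eqP Q0].
  rewrite placed_moment_empty.
  by rewrite (evalf_moment_poly hpi (upd0 _ _) (upd_natr _ _ _)).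
case: eqP => [->|/eqP nQP].
  rewrite nth_block // placed_moment_full.
  by rewrite (evalf_moment_poly hpi (upd0 _ _) (upd_natr _ _ _)).
have is0 x : (0 < insert_split N j u v x)%N.
  by rewrite /insert_split; do 3?case: ifP.
rewrite (evalf_moment_poly _ is0 (insert_split_natr _ _ _ _)).
  by congr placed_moment; apply/esym/boolp.funext => k;
    rewrite block_index_split_front.
exact: osp_split_front.
Qed.

(** The parameters of the untouched blocks together with [u] and [v] are
    size pi + 1 independent variables, and both sides are polynomial in each of
    them, so agreement at positive integers suffices. *)
Lemma split_moment_real (y : nat -> R) (u v : R) :
  evalf f (upd y j (u + v)) =
  \sum_(Q : {set 'I_n} | Q \subset P) split_moment Q y u v.
Proof.
pose p := size pi.
pose F (e : nat -> R) := evalf f (upd e j (e j + e p)) -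
  \sum_(Q : {set 'I_n} | Q \subset P) split_moment Q e (e j) (e p).
(* Entry [j] of the parameter list is free, since both sides overwrite it: it
   carries u, and the next free position, size pi, carries v. *)
pose e (k : nat) : R := if k == j then u else if k == p then v else
  if (k < p)%N then y k else 1.
have ej : e j = u by rewrite /e eqxx.
have ep : e p = v by rewrite /e gtn_eqF ?eqxx.
have ey k : (k < p)%N -> k != j -> e k = y k.
  by move=> kp kj; rewrite /e (negbTE kj) (ltn_eqF kp) kp.
have eupd (g : {malg B['X_{1..p}]}) s :
    evalf g (upd e j s) = evalf g (upd y j s).
  apply: eq_vpeval => k; rewrite !nth_mkseq // /upd.
  by case: eqP => // /eqP kj; rewrite ey.
suff : F e = 0.
  rewrite /F ej ep eupd => /eqP; rewrite subr_eq0 => /eqP->.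
  apply: eq_bigr => Q QP; rewrite /split_moment !eupd.
  case: ifP => // Q0; case: ifP => // nQP.
  apply: eq_vpeval => k; rewrite !nth_mkseq //.
  have := ltn_ord k; rewrite [X in (_ < X)%N -> _]size_split_front ?nQP //.
  rewrite /insert_split; case: (ltngtP k j) => // [kj _|jk].
    by rewrite ey ?ltn_eqF // (ltn_trans kj).
  case: eqP => //; case: (nat_of_ord k) jk => // m jm mj mp /=.
  by rewrite ey //; apply: contra_not_neq mj => ->.
apply: (separately_poly_vanish (q := p.+1)).
- move=> d x.
  have cE : forall k, exists q : {poly R}, forall s, upd d x s k = q.[s].
    move=> k; exists (if k == x then 'X else (d k)%:P) => s.
    by rewrite /upd; case: ifP; rewrite ?hornerX ?hornerC.
  have updE (c : R -> R) : (exists q : {poly R}, forall s, c s = q.[s]) ->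
      forall k, exists q : {poly R}, forall s,
        upd (upd d x s) j (c s) k = q.[s].
    move=> [q hq] k; rewrite /upd -/(upd d x _); case: (k == j).
      by exists q.
    exact: cE.
  have [g' hg'] : exists g', polyfun_deriv
      (fun s => evalf f (upd (upd d x s) j (upd d x s j + upd d x s p))) g'.
    apply: evalf_polyfun; apply: updE.
    have [[q1 h1] [q2 h2]] := (cE j, cE p).
    by exists (q1 + q2) => s; rewrite hornerD h1 h2.
  have /boolp.choice[G' hG'] : forall Q, exists g', polyfun_deriv
      (fun s => split_moment Q (upd d x s) (upd d x s j) (upd d x s p)) g'.
    move=> Q; rewrite /split_moment; case: (Q == set0).
      by apply: evalf_polyfun; apply: updE.
    case: (Q == P); first by apply: evalf_polyfun; apply: updE.
    apply: evalf_polyfun => k; rewrite /insert_split.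
    case: (k < j)%N; first exact: cE.
    case: (k == j :> nat); first exact: cE.
    by case: (k == j.+1 :> nat); exact: cE.
  by have := polyfun_derivD hg' (polyfun_derivN (polyfun_deriv_sum
    (index_enum _) (P := fun Q : {set _} => Q \subset nth set0 pi j)
    (fun Q _ => hG' Q)));
    exists (fun s => g' s - \sum_(Q : {set 'I_n} | Q \subset P) G' Q s).
- move=> d hd.
  have /boolp.choice[N hN] : forall x, exists m, (0 < m)%N /\ d x = m%:R.
    by move=> x; have [m] := hd x; exists m.
  have -> : d = fun k => (N k)%:R by apply: boolp.funext => k; case: (hN k).
  have N0 x : (0 < N x)%N by case: (hN x).
  by rewrite /F split_moment_nat ?subrr.
- move=> x px; exists 1%N => //.
  by rewrite /e !gtn_eqF // ?(ltn_trans _ px) // ltnNge ltnW.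
Qed.

(** The derivative in [u] at 0 of the additivity formula; the summand of the
    empty set does not depend on [u]. *)
Lemma deriv_split_front (y : nat -> R) (v : R) :
  pderivf f j (upd y j v) =
  \sum_(Q : {set 'I_n} | (Q != set0) && (Q \subset P))
    if Q == P then pderivf f j (upd y j 0)
    else pderivf (moment_poly S (split_front pi j Q) X) j
           (insert_split y j 0 v).
Proof.
pose G' (Q : {set 'I_n}) (s : R) : B :=
  if Q == set0 then 0 else if Q == P then pderivf f j (upd y j s)
  else pderivf (moment_poly S (split_front pi j Q) X) j
         (upd (insert_split y j 0 v) j s).
have hG Q : polyfun_deriv (fun s => split_moment Q y s v) (G' Q).
  rewrite /split_moment /G'; case: (Q == set0); first exact: polyfun_deriv_cst.
  case: (Q == P).
    by apply: polyfun_deriv_ext (evalf_deriv f j y 0) => s; rewrite addr0.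
  apply: polyfun_deriv_ext (evalf_deriv _ j (insert_split y j 0 v) 0) => s;
    rewrite addr0 //; congr evalf; apply: boolp.funext => k.
  by rewrite /upd /insert_split; case: ltngtP.
have hd := polyfun_derivD (evalf_deriv f j y v) (polyfun_derivN
  (polyfun_deriv_sum (index_enum _)
    (P := fun Q : {set _} => Q \subset nth set0 pi j) (fun Q _ => hG Q))).
have [] := polyfun_deriv_vanish hd _ 0.
  by move=> m _; rewrite split_moment_real subrr.
move=> _ /eqP; rewrite subr_eq0 add0r => /eqP->.
rewrite (bigID (fun Q => Q == set0)) /= big1 ?add0r; last first.
  by move=> Q /andP[_ Q0]; rewrite /G' Q0.
apply: eq_big => [Q|Q /andP[_ Q0]]; first by rewrite andbC.
rewrite /G' (negbTE Q0); case: ifP => // _.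
congr pderivf; apply: boolp.funext => k.
by rewrite /upd /insert_split; case: ltngtP.
Qed.

(** The derivative in [v] at 0 of the additivity formula, with the summands
    indexed by the second part of the split block; now the summand in which the
    second part is empty is constant. *)
Lemma deriv_split_back (y : nat -> R) (u : R) :
  pderivf f j (upd y j u) =
  \sum_(Q : {set 'I_n} | (Q != set0) && (Q \subset P))
    if Q == P then pderivf f j (upd y j 0)
    else pderivf (moment_poly S (split_front pi j (P :\: Q)) X) j.+1
           (insert_split y j u 0).
Proof.
pose G' (Q : {set 'I_n}) (s : R) : B :=
  if Q == set0 then pderivf f j (upd y j s) else if Q == P then 0
  else pderivf (moment_poly S (split_front pi j Q) X) j.+1
         (upd (insert_split y j u 0) j.+1 s).
have updS s : upd (insert_split y j u 0) j.+1 s = insert_split y j u s.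
  apply: boolp.funext => k; rewrite /upd /insert_split.
  case: (eqVneq k j.+1) => [->|//].
  by rewrite ltnNge leqnSn gtn_eqF.
have hG Q : polyfun_deriv (fun s => split_moment Q y u s) (G' Q).
  rewrite /split_moment /G'; case: (Q == set0).
    by apply: polyfun_deriv_ext (evalf_deriv f j y 0) => s; rewrite addr0.
  case: (Q == P); first exact: polyfun_deriv_cst.
  by apply: polyfun_deriv_ext
    (evalf_deriv _ j.+1 (insert_split y j u 0) 0) => s; rewrite addr0 ?updS.
have hd := polyfun_derivD (evalf_deriv f j y u) (polyfun_derivN
  (polyfun_deriv_sum (index_enum _)
    (P := fun Q : {set _} => Q \subset nth set0 pi j) (fun Q _ => hG Q))).
have [] := polyfun_deriv_vanish hd _ 0.
  by move=> m _; rewrite [_ + u]addrC split_moment_real subrr.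
move=> _ /eqP; rewrite subr_eq0 add0r => /eqP->.
have P0 : P != set0.
  have /and3P[pi0 _ _] := hpi; apply: contraNneq pi0 => <-.
  exact: mem_nth.
have DK (Q : {set 'I_n}) : Q \subset P -> P :\: (P :\: Q) = Q.
  by move=> QP; rewrite setDDr setDv set0U; apply/setIidPr.
rewrite (reindex_onto (fun Q => P :\: Q) (fun Q => P :\: Q)) /=; last first.
  by move=> Q; apply: DK.
rewrite (eq_bigl (fun Q : {set 'I_n} => Q \subset P)) => [|Q]; last first.
  rewrite subsetDl /=; apply/eqP/idP => [<-|]; [exact: subsetDl|exact: DK].
rewrite (bigID (fun Q => Q == set0)) /= big1 ?add0r; last first.
  move=> Q /andP[_ /eqP->]; rewrite setD0 /G' eqxx (negbTE P0) //.
apply: eq_big => [Q|Q /andP[QP Q0]]; first by rewrite andbC.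
rewrite /G' setD_eq0; case: (eqVneq Q P) => [->|nQP]; first by rewrite subxx.
rewrite ifN; last by apply: contra nQP => PQ; rewrite eqEsubset QP.
rewrite ifN ?updS //; apply: contra Q0 => /eqP e.
by rewrite -(DK Q QP) e setDv.
Qed.

End DerivativeFormula.

Theorem theorem4p3 (R : realType) (A B : assocAlgType R[i])
    (phi : {linear A -> B}) (S : spreadability_system phi)
    (n : nat) (pi : seq {set 'I_n}) (hpi : ordered_set_partition pi)
    (t : (size pi).-tuple R) (j : 'I_(size pi)) (X : 'I_n -> A) :
  vpeval (vpderiv j (moment_poly S pi X)) t =
    \sum_(Q : {set 'I_n} | (Q != set0) && (Q \subset nth set0 pi j))
      partial_cumulant S (split_front pi j Q) Q (params_front pi j Q t) X
  /\
  vpeval (vpderiv j (moment_poly S pi X)) t =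
    \sum_(Q : {set 'I_n} | (Q != set0) && (Q \subset nth set0 pi j))
      partial_cumulant S (split_back pi j Q) Q (params_back pi j Q t) X.
Proof.
have -> : vpeval (vpderiv j (moment_poly S pi X)) t =
    pderivf (moment_poly S pi X) j (upd (nth 0 t) j t`_j).
  by rewrite upd_id /pderivf valK evalf_nth.
have jt : (j < size t)%N by rewrite size_tuple.
have index_full : index (nth set0 pi j) pi = j by rewrite osp_index.
(* The distinguished block carries a conventional 1, which is overwritten by the
   value 0 at which the derivative is taken. *)
have params_full z : upd (nth 0 (take j t ++ [:: 1] ++ drop j.+1 t)) j z =
    upd (nth 0 t) j z.
  apply: boolp.funext => k; rewrite /upd; case: eqP => // /eqP kj.
  rewrite nth_cat size_take jt; case: ltngtP kj => // [kj|jk] _.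
    by rewrite nth_take.
  by rewrite -(subnKC jk) addSnnS addKn /= nth_drop addSnnS.
split.
  rewrite deriv_split_front //; apply: eq_bigr => Q /andP[Q0 QP].
  case: eqP => [->|/eqP nQP].
    rewrite split_front_full (partial_cumulantE _ _ _ index_full).
    by rewrite /params_front eqxx params_full.
  rewrite (partial_cumulantE _ _ _ (index_split_front hpi Q0 QP nQP)).
  congr pderivf; apply: boolp.funext => k.
  rewrite /params_front (negbTE nQP) /upd nth_insert_split // /insert_split.
  by case: ltngtP.
rewrite deriv_split_back //; apply: eq_bigr => Q /andP[Q0 QP].
case: eqP => [->|/eqP nQP].
  rewrite split_back_full (partial_cumulantE _ _ _ index_full).
  by rewrite /params_back eqxx params_full.
have DQ : nth set0 pi j :\: (nth set0 pi j :\: Q) = Q.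
  by rewrite setDDr setDv set0U; apply/setIidPr.
have D0 : nth set0 pi j :\: Q != set0.
  by rewrite setD_eq0; apply: contra nQP => PQ; rewrite eqEsubset QP.
have nDP : nth set0 pi j :\: Q != nth set0 pi j.
  by apply: contra Q0 => /eqP e; rewrite -DQ e setDv.
have := index_split_front_rest hpi D0 (subsetDl _ _) nDP.
rewrite DQ (split_back_front Q0 QP nQP) => /partial_cumulantE ->.
congr pderivf; apply: boolp.funext => k.
rewrite /params_back (negbTE nQP) /upd nth_insert_split // /insert_split.
case: (eqVneq k j.+1) => [->|//].
by rewrite ltnNge leqnSn gtn_eqF.
Qed.
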